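(* Consider, for $k=1,2,\ldots$, the $E_k/M^Y/1$ queues described in the context, with common mean inter-arrival time $1/\lambda^*$, common service rate $\mu$ and common batch size distribution, satisfying $\lambda^*<\mu\,\mathsf E\,Y$. Under the stationary distribution let $L_k$ be the mean number of customers in the system, $W_k$ the expected sojourn time of a customer, and $V_k$ the variance of the number of customers in the system. Then $$L_{k+1}\le L_k,\qquad W_{k+1}\le W_k,\qquad V_{k+1}\le V_k,\qquad k=1,2,\ldots.$$
   Context: $E_k/M^Y/1$ queue: inter-arrival times are i.i.d. Erlang, i.e. sums of $k$ independent exponential phases each with rate $\lambda_k=k\lambda^*$ (so the mean inter-arrival time is $1/\lambda^*$). A single server performs batch services: as long as the system is non-empty, services are completed at rate $\mu>0$; the batch size $Y$ is independent with $P\{Y=j\}=p_j$, $1\le j\le b$, $\sum_{j=1}^bp_j=1$, and $\min(Y,\text{number of customers present})$ customers leave. The condition $\lambda^*<\mu\,\mathsf E\,Y$ is the ergodicity condition, assumed throughout. $L_k=\sum_m m\,\bar\pi^k_m$, where $\bar\pi^k_m$ is the stationary probability of $m$ customers in the system. *)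

(* Defs.v *)
From HB Require Import structures.
From mathcomp Require Import all_boot all_order all_algebra.
From mathcomp Require Import all_classical all_reals all_analysis.

Set Implicit Arguments.
Unset Strict Implicit.
Unset Printing Implicit Defensive.

Import Order.TTheory GRing.Theory Num.Theory.
Import numFieldNormedType.Exports.

Local Open Scope classical_set_scope.
Local Open Scope ring_scope.

(* Stationary distribution of the continuous-time Markov chain on S with jump
   rates q (bounded rates in all uses below): a probability vector satisfying
   the global balance equations, inflow = outflow at every state. Diagonal
   entries of q contribute equally to both sides and are thus immaterial. *)
Definition stationary_distribution (R : realType) (S : choiceType)
    (q : S -> S -> R) (pi : S -> R) : Prop :=
  [/\ forall x, 0 <= pi x,
      \esum_(x in [set: S]) (pi x)%:E = 1%E
    & forall y, \esum_(x in [set: S]) (pi x * q x y)%:E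
              = \esum_(x in [set: S]) (pi y * q y x)%:E].

(* A state (m, i) of the E_k/M^Y/1 queue: m customers are present and i of the
   k phases of the current inter-arrival time are completed. Each phase has
   rate k * lambda; completing the last one is an arrival. Batches have size j
   with probability p j, 1 <= j <= b; as subtraction on nat is truncated,
   m - j = m - min(j, m). *)
Definition queue_rate (R : realType) (lambda mu : R) (b : nat) (p : nat -> R)
    (k : nat) (x y : nat * 'I_k) : R :=
  (k%:R * lambda) *+ ((y.1 == x.1) && (y.2 == x.2.+1 :> nat))
  + (k%:R * lambda)
      *+ [&& x.2.+1 == k, y.1 == x.1.+1 & y.2 == 0%N :> nat]
  + (\sum_(1 <= j < b.+1 | y.1 == (x.1 - j)%N) mu * p j)
      *+ ((0 < x.1)%N && (y.2 == x.2)).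

Definition queue_stationary (R : realType) (lambda mu : R) (b : nat)
    (p : nat -> R) (k : nat) (pi : nat * 'I_k -> R) : Prop :=
  stationary_distribution (@queue_rate R lambda mu b p k) pi.

Definition customers_pmf (R : realType) (k : nat) (pi : nat * 'I_k -> R)
    (m : nat) : R := \sum_(i < k) pi (m, i).

Definition mean_customers (R : realType) (k : nat) (pi : nat * 'I_k -> R) :
    \bar R :=
  (\sum_(m <oo) (m%:R * customers_pmf pi m)%:E)%E.

Definition variance_customers (R : realType) (k : nat) (pi : nat * 'I_k -> R) :
    \bar R :=
  (\sum_(m <oo)
     ((m%:R - fine (mean_customers pi)) ^+ 2 * customers_pmf pi m)%:E)%E.

(* Distribution of the number of customers found by an arrival in steady state.
   Arrivals occur at the constant rate k * lambda exactly while the arrival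
   process is in its last phase, so this is pi conditioned on the last phase. *)
Definition last_phase_pmf (R : realType) (k : nat) (pi : nat * 'I_k -> R)
    (m : nat) : R := \sum_(i < k | i.+1 == k) pi (m, i).

Definition arrival_pmf (R : realType) (k : nat) (pi : nat * 'I_k -> R)
    (m : nat) : R :=
  last_phase_pmf pi m / fine (\sum_(n <oo) (last_phase_pmf pi n)%:E)%E.

(* A customer arriving in steady state: it finds [found] customers ahead of it;
   from its arrival on, the successive service durations are [service 0],
   [service 1], ..., i.i.d. exponential with rate mu (for a service in progress,
   by memorylessness, service 0 is the residual duration), and the successive
   batch sizes are [batch 0], [batch 1], ..., i.i.d. with law p on {1, ..., b}.
   [tagged_law] states both these laws and the mutual independence of all these
   random variables. *)
Record tagged_customer (R : realType) (mu : R) (b : nat) (p : nat -> R)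
    (k : nat) (pi : nat * 'I_k -> R) := TaggedCustomer {
  tagged_display : measure_display ;
  tagged_space : measurableType tagged_display ;
  tagged_prob : probability tagged_space R ;
  found : {RV tagged_prob >-> nat} ;
  batch : nat -> {RV tagged_prob >-> nat} ;
  service : nat -> {RV tagged_prob >-> R} ;
  service_ge0 : forall i w, 0 <= service i w ;
  tagged_law : forall (n m : nat) (j : nat -> nat) (A : nat -> set R),
    (forall i, measurable (A i)) ->
    tagged_prob [set w | found w = m /\ forall i, (i < n)%N ->
                           batch i w = j i /\ A i (service i w)]
    = (arrival_pmf pi m
       * \prod_(i < n) (p (j i) *+ (1 <= j i <= b)%N
                        * fine (exponential_prob mu (A i))))%:E }.

(* Service in order of arrival: batches are taken from the head of the queue,
   so after i service completions the customer is still present if and only if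
   the first i batch sizes add up to at most the number of customers found. *)
Definition sojourn_time (R : realType) (mu : R) (b : nat) (p : nat -> R)
    (k : nat) (pi : nat * 'I_k -> R) (C : tagged_customer mu b p pi)
    (w : tagged_space C) : \bar R :=
  (\sum_(i <oo) (service C i w
     *+ (\sum_(l < i) batch C l w <= found C w)%N)%:E)%E.

Definition mean_sojourn (R : realType) (mu : R) (b : nat) (p : nat -> R)
    (k : nat) (pi : nat * 'I_k -> R) (C : tagged_customer mu b p pi) : \bar R :=
  (\int[tagged_prob C]_w sojourn_time w)%E.

(* Main.v *)
Require Import Defs.
From mathcomp Require Import all_boot all_order all_algebra.
From mathcomp Require Import all_classical all_reals all_analysis.
From mathcomp Require Import measurable_realfun.
From mathcomp Require Import ring lra zify.
Set Implicit Arguments.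
Unset Strict Implicit.
Unset Printing Implicit Defensive.
Import Order.TTheory GRing.Theory Num.Theory.
Import numFieldNormedType.Exports.
Local Open Scope classical_set_scope.
Local Open Scope ring_scope.

(** Let [y] in (0, 1) solve [mu * crossing k y = k * lambda]: listing the states
    (m, i) as [n = k m + i], this balances, for a geometric measure of ratio [y],
    the upward and downward flows through a cut.  Write [x = y ^ k] and [Y] for
    the generating function of the batch sizes.

    From [k - 1] on, a stationary distribution solves a linear recurrence whose
    solutions that tend to [0] form a line, so it is geometric with ratio [y];
    the balance equations with no customer and the total mass then determine it.
    The number of customers has law [P(m+1) = L (1 - x)^2 x^m] with
    [L = lambda / (mu (1 - Y(x)))], and an arrival finds a geometric number of
    customers with ratio [x].  The mean [L], the variance
    [L ((1 + x) / (1 - x) - L)] and the mean sojourn time (a sum over [i] of the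
    probability that the [i]-th service is needed, times a constant) are then
    nondecreasing functions of [x] alone.

    The ratio [x] decreases with [k] by the AM-GM inequality
    [(1 + t)^k <= (1 + k t / (k + 1))^(k + 1)]. *)

(** * The crossing equation: its root in (0, 1), and the root as a function of [k] *)

Section CrossingEquation.
Variables (R : realType) (b : nat) (p : nat -> R).
Hypothesis p_ge0 : forall j, (1 <= j <= b)%N -> 0 <= p j.
Hypothesis p_sum1 : \sum_(1 <= j < b.+1) p j = 1.

Definition batch_pgf (x : R) : R := \sum_(1 <= j < b.+1) p j * x ^+ j.

(* A batch of size [j] takes the phase count [k m + i] down by [k j]. *)
Definition crossing (k : nat) (y : R) : R :=
  \sum_(1 <= j < b.+1) p j * \sum_(0 <= l < k * j) y ^+ l.+1.

Lemma ler_sum_batch (f g : nat -> R) :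
  (forall j, (1 <= j <= b)%N -> f j <= g j) ->
  \sum_(1 <= j < b.+1) p j * f j <= \sum_(1 <= j < b.+1) p j * g j.
Proof.
move=> fg; rewrite big_nat [leRHS]big_nat; apply: ler_sum => j jb.
by apply: ler_wpM2l; [exact: p_ge0|exact: fg].
Qed.

Lemma le_batch_pgf (x x' : R) : 0 <= x' <= x -> batch_pgf x' <= batch_pgf x.
Proof.
move=> /andP[x0 xx]; apply: ler_sum_batch => j _.
by apply: lerXn2r; rewrite ?nnegrE // (le_trans x0).
Qed.

(** Every inner sum starts with the term [y] itself because [k j >= 1]; the other terms are
    nondecreasing and the weights [p j] add up to 1. *)
Lemma crossing_gap (k : nat) (y z : R) : (0 < k)%N -> 0 <= y <= z ->
  z - y <= crossing k z - crossing k y.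
Proof.
move=> k0 /andP[y0 yz]; rewrite /crossing -sumrB.
rewrite -[leLHS]mul1r -[X in X * _]p_sum1 mulr_suml.
under [leRHS]eq_bigr do rewrite -mulrBr.
apply: ler_sum_batch => j /andP[j1 _].
have kj : (0 < k * j)%N by rewrite muln_gt0 k0.
rewrite -sumrB big_ltn // lerDl big_nat sumr_ge0 // => l _.
by rewrite subr_ge0 lerXn2r ?nnegrE // (le_trans y0).
Qed.

Lemma crossing_le_inv (k : nat) (y z : R) : (0 < k)%N -> 0 <= y -> 0 <= z ->
  crossing k y <= crossing k z -> y <= z.
Proof.
move=> k0 y0 z0 yz; rewrite leNgt; apply/negP => zy.
have := @crossing_gap k z y k0; rewrite z0 ltW// => /(_ isT).
lra.
Qed.

(** The inner geometric sums telescope. This trades the crossing function at [y] for the generating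
    function at [x = y ^ k]. *)
Lemma crossing_geometric (k : nat) (y : R) :
  (1 - y) * crossing k y = y * (1 - batch_pgf (y ^+ k)).
Proof.
rewrite -[X in y * (X - _)]p_sum1 /batch_pgf -sumrB mulr_sumr [RHS]mulr_sumr.
apply: eq_bigr => j _; rewrite -exprM.
under eq_bigr do rewrite exprS.
rewrite -mulr_sumr big_mkord.
have -> : y ^+ (k * j) = 1 - (1 - y) * \sum_(i < k * j) y ^+ i.
  by rewrite -[LHS](subrK 1) subrX1; ring.
ring.
Qed.

(** Intermediate values of a polynomial: it is negative at 0, and at 1 the crossing function equals
    [k] times the mean batch size, so positivity there is exactly ergodicity. *)
Lemma crossing_root (lambda mu : R) (k : nat) : 0 < lambda -> 0 < mu ->
  lambda < mu * \sum_(1 <= j < b.+1) j%:R * p j -> (0 < k)%N ->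
  exists2 y, 0 < y < 1 & mu * crossing k y = k%:R * lambda.
Proof.
move=> l0 mu0 erg k0.
pose P : {poly R} := mu *: (\sum_(1 <= j < b.+1) p j *: \sum_(0 <= l < k * j) 'X^(l.+1))
  - (k%:R * lambda)%:P.
have PE y : P.[y] = mu * crossing k y - k%:R * lambda.
  rewrite /P hornerD hornerZ hornerN hornerC horner_sum.
  congr (_ * _ - _); apply: eq_bigr => j _; rewrite hornerZ horner_sum.
  by congr (_ * _); apply: eq_bigr => l _; rewrite hornerXn.
have P0 : P.[0] < 0.
  rewrite PE; suff -> : crossing k 0 = 0 by rewrite mulr0 sub0r oppr_lt0 mulr_gt0 ?ltr0n.
  by apply: big1 => j _; rewrite big1 ?mulr0 // => l _; rewrite expr0n.
have P1 : 0 < P.[1].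
  rewrite PE subr_gt0.
  suff -> : crossing k 1 = k%:R * \sum_(1 <= j < b.+1) j%:R * p j.
    by rewrite mulrCA ltr_pM2l ?ltr0n.
  rewrite mulr_sumr; apply: eq_bigr => j _.
  under eq_bigr do rewrite expr1n.
  rewrite sumr_const_nat subn0 natrM; ring.
have /(_ _)[||y /andP[y0 y1] /rootP Py] := @poly_ivt R P 0 1.
- exact: ler01.
- by rewrite !ltW.
exists y; last by move: Py; rewrite PE; lra.
rewrite !lt_neqAle y0 y1 !andbT; apply/andP; split; apply/eqP => yE.
  by move: P0; rewrite {1}yE Py ltxx.
by move: P1; rewrite -{1}yE Py ltxx.
Qed.

(** AM-GM for [k + 1] numbers, one equal to 1 and [k] equal to [1 + t]. *)
Lemma bernoulli_succ (k : nat) (t : R) : 0 <= t ->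
  (1 + t) ^+ k <= (1 + k%:R * t / k.+1%:R) ^+ k.+1.
Proof.
move=> t0; pose E (i : 'I_k.+1) : R := if i == ord0 then 1 else 1 + t.
have E0 : {in 'I_k.+1, forall i, 0 <= E i}.
  by move=> i _; rewrite /E; case: ifP => _ //; lra.
have := (leif_AGM E0).1; rewrite card_ord.
have -> : \prod_(i in 'I_k.+1) E i = (1 + t) ^+ k.
  rewrite big_ord_recl /E eqxx mul1r (eq_bigr (fun=> 1 + t)) //.
  by rewrite prodr_const card_ord.
have -> : \sum_(i in 'I_k.+1) E i = 1 + k%:R * (1 + t).
  rewrite big_ord_recl /E eqxx (eq_bigr (fun=> 1 + t)) //.
  by rewrite sumr_const card_ord mulr_natl.
suff -> : (1 + k%:R * (1 + t)) / k.+1%:R = 1 + k%:R * t / k.+1%:R :> R by [].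
by rewrite -natr1; field; rewrite natr1 pnatr_eq0.
Qed.

(* [u^-1] is the ratio for [k + 1] at which the rates of the upward crossings
   agree: [(k + 1) (u - 1) = k (y^-1 - 1)]. *)
Lemma crossing_root_decreasing (lambda mu : R) (k : nat) (y y' : R) : 0 < mu ->
  (0 < k)%N -> 0 < y < 1 -> 0 < y' < 1 ->
  mu * crossing k y = k%:R * lambda ->
  mu * crossing k.+1 y' = k.+1%:R * lambda ->
  y' ^+ k.+1 <= y ^+ k.
Proof.
move=> mu0 k0 /andP[y0 y1] /andP[y'0 y'1] hy hy'.
have kR : 0 < k%:R :> R by rewrite ltr0n.
pose t := y^-1 - 1.
have t0 : 0 < t by rewrite subr_gt0 invf_gt1.
pose u := 1 + k%:R * t / k.+1%:R.
have u1 : 1 < u by rewrite ltrDl divr_gt0 ?mulr_gt0 ?ltr0n.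
have u0 : 0 < u by lra.
(* AM-GM with [1 + t = y^-1]; what remains is [y' <= u^-1]. *)
have wy : u^-1 ^+ k.+1 <= y ^+ k.
  have := @bernoulli_succ k t (ltW t0); rewrite -/u.
  have -> : 1 + t = y^-1 by rewrite /t; ring.
  by rewrite exprVn exprVn -[leRHS]invrK lef_pV2 ?posrE ?invr_gt0 ?exprn_gt0.
have w0 : 0 <= u^-1 by rewrite invr_ge0 ltW.
apply: le_trans (wy); apply: lerXn2r; rewrite ?nnegrE ?(ltW y'0)//.
apply: (@crossing_le_inv k.+1 _ _ (ltn0Sn k) (ltW y'0) w0).
have gy := crossing_geometric k y.
have gw := crossing_geometric k.+1 u^-1.
have := @le_batch_pgf (y ^+ k) (u^-1 ^+ k.+1).
rewrite wy exprn_ge0 ?invr_ge0 ?(ltW u0)// => /(_ isT) Yw.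
rewrite -(ler_pM2l mu0) hy'.
have e1 : (u - 1) * crossing k.+1 u^-1 = 1 - batch_pgf (u^-1 ^+ k.+1).
  have -> : (u - 1) * crossing k.+1 u^-1 = u * ((1 - u^-1) * crossing k.+1 u^-1).
    by field; rewrite gt_eqF.
  by rewrite gw mulrA mulfV ?mul1r ?gt_eqF.
have e2 : t * crossing k y = 1 - batch_pgf (y ^+ k).
  have -> : t * crossing k y = y^-1 * ((1 - y) * crossing k y).
    by rewrite /t; field; rewrite gt_eqF.
  by rewrite gy mulrA mulVf ?mul1r ?gt_eqF.
have u1E : u - 1 = k%:R * t / k.+1%:R by rewrite /u; ring.
(* The right sides of [e1] and [e2] compare by [wy], the generating function being nondecreasing.
   Since [u - 1 = k t / (k + 1)], cancelling [t] bounds the crossing function for [k + 1] at [u^-1]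
   from below by its value at [y']. *)
have : t * crossing k y <= (u - 1) * crossing k.+1 u^-1 by rewrite e1 e2; lra.
have -> : (u - 1) * crossing k.+1 u^-1 = t * (k%:R / k.+1%:R * crossing k.+1 u^-1).
  by rewrite u1E; ring.
rewrite (ler_pM2l t0) -(ler_pM2l mu0) hy => le.
have k1 : 0 < k.+1%:R :> R by rewrite ltr0n.
rewrite -(ler_pM2l (divr_gt0 kR k1)).
have -> : k%:R / k.+1%:R * (k.+1%:R * lambda) = k%:R * lambda.
  by field; apply: lt0r_neq0; lra.
by apply: le_trans le _; rewrite mulrCA.
Qed.
End CrossingEquation.

(** * Uniqueness for solutions of the recurrence that tend to zero *)

Section DecayingRecurrence.
Variables (R : realType) (b : nat) (p : nat -> R).
Hypothesis p_ge0 : forall j, (1 <= j <= b)%N -> 0 <= p j.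
Hypothesis p_sum1 : \sum_(1 <= j < b.+1) p j = 1.

(* Summing absolute values over the first [N] equations, everything cancels
   except [mu * `|d 1|] and a window of [k b + 1] terms starting at [N]. *)
Lemma decaying_recurrence_step (alpha mu : R) (k : nat) (d : nat -> R) :
  0 <= alpha -> 0 < mu -> (0 < k)%N -> d 0%N = 0 -> d @ \oo --> 0 ->
  (forall n, (alpha + mu) * d n.+1 =
     alpha * d n + mu * \sum_(1 <= j < b.+1) p j * d (n.+1 + k * j)%N) ->
  d 1%N = 0.
Proof.
move=> a0 mu0 k0 d0 dcvg rec.
pose e n := `|d n|; pose M := (k * b).+1.
have e_ge0 n : 0 <= e n by rewrite /e.
have erec n : (alpha + mu) * e n.+1 <=
    alpha * e n + mu * \sum_(1 <= j < b.+1) p j * e (n.+1 + k * j)%N.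
  rewrite /e -[alpha + mu]ger0_norm ?addr_ge0 ?(ltW mu0)// -normrM rec.
  apply: le_trans (ler_normD _ _) _; rewrite !normrM ger0_norm// (gtr0_norm mu0).
  rewrite lerD2l ler_pM2l//; apply: le_trans (ler_norm_sum _ _ _) _.
  rewrite big_nat [leRHS]big_nat; apply: ler_sum => j jb.
  by rewrite normrM ger0_norm// p_ge0.
have main N : e 1%N <= \sum_(0 <= l < M) e (N + l).+1.
  have sumrec : (alpha + mu) * \sum_(0 <= n < N) e n.+1 <=
      alpha * \sum_(0 <= n < N) e n + mu * \sum_(1 <= j < b.+1) p j *
        \sum_(0 <= n < N) e (n.+1 + k * j)%N.
    under [X in _ <= _ + mu * X]eq_bigr do rewrite mulr_sumr.
    rewrite exchange_big !mulr_sumr -big_split; exact: ler_sum.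
  have shift0 : \sum_(0 <= n < N) e n <= \sum_(0 <= n < N) e n.+1.
    case: N {sumrec} => [|N]; first by rewrite !big_geq.
    by rewrite big_nat_recl// /e d0 normr0 add0r big_nat_recr//= lerDl.
  (* All shifts [k j] lie between 1 and [k b], so this one sum, over the indices from 2 to
     [N + k b + 1], dominates every shifted sum. *)
  pose T := \sum_(0 <= n < N + k * b) e n.+2.
  have shiftj j : (1 <= j <= b)%N -> \sum_(0 <= n < N) e (n.+1 + k * j)%N <= T.
    move=> /andP[j1 jb]; have kj : (0 < k * j)%N by rewrite muln_gt0 k0.
    have kjb : (k * j <= k * b)%N by rewrite leq_mul2l jb orbT.
    pose c := (k * j).-1.
    have -> : \sum_(0 <= n < N) e (n.+1 + k * j)%N = \sum_(c <= n < N + c) e n.+2.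
      rewrite -{1}[c]add0n big_addn addnK.
      by apply: eq_bigr => n _; congr e; rewrite /c; lia.
    rewrite /T (@big_cat_nat _ _ _ c 0 (N + k * b)) //=; last by rewrite /c; lia.
    rewrite (@big_cat_nat _ _ _ (N + c) c (N + k * b)) //= ?leq_addl//; last by rewrite /c; lia.
    by rewrite addrCA lerDl addr_ge0 ?sumr_ge0.
  have TE : T = \sum_(0 <= n < N) e n.+1 + \sum_(0 <= l < M) e (N + l).+1 - e 1%N.
    have -> : \sum_(0 <= l < M) e (N + l).+1 = \sum_(N <= l < N + M) e l.+1.
      rewrite -{2}[N]add0n big_addn addKn.
      by apply: eq_bigr => l _; rewrite addnC.
    rewrite -big_cat_nat//= ?leq_addr// addnS big_nat_recl//.
    by rewrite addrAC subrr add0r.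
  have : \sum_(1 <= j < b.+1) p j * \sum_(0 <= n < N) e (n.+1 + k * j)%N <= T.
    rewrite -[T]mul1r -p_sum1 mulr_suml big_nat [leRHS]big_nat.
    by apply: ler_sum => j jb; rewrite ler_wpM2l ?p_ge0 ?shiftj.
  rewrite -(ler_pM2l mu0) => sT.
  have := ler_wpM2l a0 shift0 => sa.
  rewrite -(ler_pM2l mu0); move: sT; rewrite TE mulrBr mulrDr; lra.
(* The window length [M] does not depend on [N]: if [e 1] were positive, far enough out each of the
   [M] terms would fall below [e 1 / M], against [main]. *)
apply/normr0_eq0/eqP; rewrite eq_le normr_ge0 andbT leNgt; apply/negP => e1.
have eps : 0 < e 1%N / M%:R by rewrite divr_gt0 ?ltr0n.
have [N _ small] := (cvgr0Pnorm_lt d).1 dcvg _ eps.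
have := main N; rewrite leNgt => /negP; apply.
have -> : e 1%N = \sum_(0 <= l < M) (e 1%N / M%:R).
  rewrite sumr_const_nat subn0 -[RHS]mulr_natr divfK ?pnatr_eq0//.
by apply: ltr_sum_nat => // l _; apply: small => /=; lia.
Qed.

(** The recurrence is invariant under shifts, and once [d 1 = 0] the shifted sequence satisfies all
    the hypotheses again. *)
Lemma decaying_recurrence_zero (alpha mu : R) (k : nat) (d : nat -> R) :
  0 <= alpha -> 0 < mu -> (0 < k)%N -> d 0%N = 0 -> d @ \oo --> 0 ->
  (forall n, (alpha + mu) * d n.+1 =
     alpha * d n + mu * \sum_(1 <= j < b.+1) p j * d (n.+1 + k * j)%N) ->
  forall n, d n = 0.
Proof.
move=> a0 mu0 k0 d0 dcvg rec n; elim: n d d0 dcvg rec => [//|n IHn] d d0 dcvg rec.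
apply: (IHn (d \o S)) => [/=||m]; last exact: rec.
  exact: (@decaying_recurrence_step alpha mu k).
by have := dcvg; rewrite -(cvg_shiftn 1); under eq_fun do rewrite addn1.
Qed.
End DecayingRecurrence.

(** * Sums over finite types, over levels and phases, and extended real series *)

Lemma fsbig_finType (V : Type) (idx : V) (op : Monoid.com_law idx) (T : finType)
    (f : T -> V) :
  \big[op/idx]_(x \in [set: T]) f x = \big[op/idx]_x f x.
Proof.
rewrite (fsbigE (enum T)) ?enum_uniq//; last first.
  by move=> x _; rewrite mem_enum inE.
rewrite big_mkcond /= big_enum /=; apply: eq_bigr => x _.
by rewrite in_setT.
Qed.

Lemma esum_finType (R : realType) (T : finType) (f : T -> \bar R) :
  (forall x, 0 <= f x)%E ->
  \esum_(x in [set: T]) f x = (\sum_x f x)%E.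
Proof.
move=> f0; rewrite esum_fset//; last exact: finite_finset.
exact: fsbig_finType.
Qed.

Lemma esum_nat_finType (R : realType) (T : finType) (f : nat * T -> \bar R) :
  (forall x, 0 <= f x)%E ->
  \esum_(x in [set: nat * T]) f x = (\sum_(m <oo) \sum_x f (m, x))%E.
Proof.
move=> f0; rewrite nneseries_esumT => [|m]; last exact: sume_ge0.
under [RHS]eq_esum => m _ do rewrite -(@esum_finType _ _ (fun x => f (m, x)))//.
rewrite (esum_esum (a := fun m x => f (m, x)))//.
have -> : [set: nat] `*`` (fun=> [set: T]) = [set: nat * T].
  by apply/seteqP; split.
by apply: eq_esum => -[].
Qed.

Lemma nneseries_finite_support (R : realType) (f : nat -> R) (N : nat) :
  (forall m, 0 <= f m) -> (forall m, (N <= m)%N -> f m = 0) ->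
  (\sum_(m <oo) (f m)%:E)%E = (\sum_(m < N) f m)%:E.
Proof.
move=> f_ge0 f0; rewrite (nneseries_split 0 N) => [|m _]; last by rewrite lee_fin.
rewrite add0n eseries0 ?adde0 => [|m Nm _]; last by rewrite f0.
by rewrite big_mkord sumEFin.
Qed.

Lemma esum_nat_finType_finite_support (R : realType) (T : finType)
    (f : nat * T -> R) (N : nat) :
  (forall x, 0 <= f x) -> (forall m x, (N <= m)%N -> f (m, x) = 0) ->
  \esum_(x in [set: nat * T]) (f x)%:E = (\sum_(m < N) \sum_x f (nat_of_ord m, x))%:E.
Proof.
move=> f_ge0 f0; rewrite esum_nat_finType => [|x]; last by rewrite lee_fin.
rewrite -(nneseries_finite_support (f := fun m => \sum_x f (m, x))) => [||m Nm].
- by apply: eq_eseriesr => m _; rewrite sumEFin.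
- by move=> m; exact: sumr_ge0.
- by rewrite big1 // => x _; rewrite f0.
Qed.

Lemma sum_ord_delta (V : nmodType) (N a : nat) (F : nat -> V) : (a < N)%N ->
  \sum_(m < N) F m *+ (m == a :> nat) = F a.
Proof.
move=> aN; rewrite (bigD1 (Ordinal aN)) //= eqxx mulr1n big1 ?addr0 // => i.
by rewrite -val_eqE /= => /negbTE ->.
Qed.

Lemma sum_ord_delta_and (V : nmodType) (N a : nat) (T : finType)
    (F : nat -> T -> V) (P : nat -> pred T) : (a < N)%N ->
  \sum_(m < N) \sum_x F m x *+ ((m == a :> nat) && P m x)
  = \sum_x F a x *+ P a x.
Proof.
move=> aN; rewrite -(sum_ord_delta (fun m => \sum_x F m x *+ P m x) aN).
apply: eq_bigr => m _; case: eqP => [->|_]; first by rewrite mulr1n.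
by rewrite mulr0n big1.
Qed.

Lemma cvg_series_eseries (R : realType) (u : nat -> R) (S : R) :
  series u @ \oo --> S -> (\sum_(m <oo) (u m)%:E = S%:E)%E.
Proof.
move=> uS; apply/cvg_lim => //.
have -> : (fun n => \sum_(0 <= i < n) (u i)%:E)%E = EFin \o series u.
  by apply/funext => n; rewrite /= sumEFin.
by apply: cvg_EFin uS; exact: nearW.
Qed.

Lemma eseries_cvg_series (R : realType) (u : nat -> R) (S : R) :
  (forall m, 0 <= u m) ->
  (\sum_(m <oo) (u m)%:E = S%:E)%E -> series u @ \oo --> S.
Proof.
move=> u0 uS.
have -> : series u = fine \o (fun n => \sum_(0 <= i < n) (u i)%:E)%E.
  by apply/funext => n; rewrite /= sumEFin.
apply: fine_cvg; rewrite -uS.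
by apply: is_cvg_nneseries => n _ _; rewrite lee_fin.
Qed.

(** * Balance equations of the queue *)

Definition mean_level (R : realType) (lambda mu : R) (b : nat) (p : nat -> R) (x : R) : R :=
  lambda / (mu * (1 - batch_pgf b p x)).

Section Balance.
Variables (R : realType) (lambda mu : R) (b : nat) (p : nat -> R) (K : nat).
Hypotheses (lambda_gt0 : 0 < lambda) (mu_gt0 : 0 < mu).
Hypothesis p_ge0 : forall j, (1 <= j <= b)%N -> 0 <= p j.
Hypothesis p_sum1 : \sum_(1 <= j < b.+1) p j = 1.

Let k : nat := K.+1.
Local Notation rate := (@queue_rate R lambda mu b p k).

Lemma queue_rate_ge0 (x y : nat * 'I_k) : 0 <= rate x y.
Proof.
rewrite /queue_rate !addr_ge0 ?mulrn_wge0 ?mulr_ge0 ?ler0n ?(ltW lambda_gt0)//.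
rewrite big_nat_cond sumr_ge0 // => j /andP[jb _].
by rewrite mulr_ge0 ?(ltW mu_gt0) ?p_ge0.
Qed.

Lemma queue_outflow (pi : nat * 'I_k -> R) (M : nat) (i0 : 'I_k) :
  (forall x, 0 <= pi x) ->
  \esum_(x in [set: nat * 'I_k]) (pi (M, i0) * rate (M, i0) x)%:E =
  (pi (M, i0) * (k%:R * lambda + mu *+ (0 < M)%N))%:E.
Proof.
move=> pi_ge0.
(* A jump raises the number of customers by at most one. *)
rewrite (@esum_nat_finType_finite_support _ _ _ M.+2) => [|x|m i Mm]; last 2 first.
- by rewrite mulr_ge0 ?queue_rate_ge0.
- have -> : rate (M, i0) (m, i) = 0; last by rewrite mulr0.
  have [mM mM1] : (m == M) = false /\ (m == M.+1) = false by split; lia.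
  rewrite /queue_rate /= mM mM1 andbF !mulr0n !add0r big_nat_cond big1 ?mul0rn// => j.
  by case/andP=> [_ /eqP]; lia.
congr (_%:E).
under eq_bigr do rewrite -mulr_sumr; rewrite -mulr_sumr; congr (_ * _).
under eq_bigr do rewrite /queue_rate /= !big_split /=.
rewrite !big_split /=; congr (_ + _).
  rewrite (@sum_ord_delta_and _ _ M _ (fun _ _ => k%:R * lambda)
    (fun _ (i : 'I_k) => i == i0.+1 :> nat))//.
  under [X in _ + X]eq_bigr do under eq_bigr do rewrite andbCA.
  rewrite (@sum_ord_delta_and _ _ M.+1 _ (fun _ _ => k%:R * lambda)
    (fun _ (i : 'I_k) => (i0.+1 == k) && (i == 0%N :> nat)))//.
  (* Completing a phase has a single target: the next level after the last phase, the next phase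
     otherwise. *)
  case: (eqVneq i0.+1 k) => [i0k|i0k] /=.
    rewrite (@sum_ord_delta _ _ 0 (fun _ => k%:R * lambda))//.
    by rewrite big1 ?add0r// => i _; rewrite ltn_eqF// i0k.
  rewrite (sum_ord_delta (fun _ => k%:R * lambda)); last by have := ltn_ord i0; lia.
  by rewrite big1 // addr0.
case: M => [|M]; first by rewrite mulr0n big1 // => m _; rewrite big1.
rewrite /= mulr1n.
transitivity (\sum_(m < M.+3) \sum_(1 <= j < b.+1 | m == (M.+1 - j)%N :> nat) mu * p j).
  apply: eq_bigr => m _.
  by rewrite (bigD1 i0) //= eqxx mulr1n [X in _ + X]big1 ?addr0 // => i /negbTE ->.
under eq_bigr do rewrite big_mkcond /=.
rewrite exchange_big /= -[RHS]mulr1 -p_sum1 mulr_sumr.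
apply: eq_big_nat => j /andP[j1 jb].
have MjM : (M.+1 - j < M.+3)%N by lia.
rewrite -[RHS](sum_ord_delta (fun _ => mu * p j) MjM).
by apply: eq_bigr => m _; rewrite mulrb.
Qed.

(** With the states listed as [n = k M + i], this is the mass at [n - 1], the only state from which
    a phase completion leads to [n]; the value 0 stands for the missing predecessor of [n = 0]. *)
Definition previous_phase (pi : nat * 'I_k -> R) (M : nat) (i : 'I_k) : R :=
  if i == 0%N :> nat then (if M is M'.+1 then pi (M', ord_max) else 0)
  else pi (M, inord i.-1).

(** The condition [0 < m] keeps out services in an empty system, which truncated subtraction would
    count as staying at level 0. *)
Lemma queue_inflow (pi : nat * 'I_k -> R) (M : nat) (i0 : 'I_k) :
  (forall x, 0 <= pi x) ->
  \esum_(x in [set: nat * 'I_k]) (pi x * rate x (M, i0))%:E =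
  (k%:R * lambda * previous_phase pi M i0 + mu * \sum_(1 <= j < b.+1)
     p j * \sum_(m < (M + b).+1 | (0 < m)%N && (M == m - j)%N) pi (val m, i0))%:E.
Proof.
move=> pi_ge0.
(* Batches have size at most [b], so no level above [M + b] reaches [M] in one jump. *)
rewrite (@esum_nat_finType_finite_support _ _ _ (M + b).+1) => [|x|m i Mm]; last 2 first.
- by rewrite mulr_ge0 ?queue_rate_ge0.
- have -> : rate (m, i) (M, i0) = 0; last by rewrite mulr0.
  have [mM mM1] : (M == m) = false /\ (M == m.+1) = false by split; lia.
  rewrite /queue_rate /= mM mM1 andbF !mulr0n !add0r big_nat_cond big1 ?mul0rn// => j.
  by case/andP=> [/andP[? ?] /eqP]; lia.
congr (_%:E).
under eq_bigr do under eq_bigr do rewrite /queue_rate /= !mulrDr !mulrnAr.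
under eq_bigr do rewrite !big_split /=.
rewrite !big_split /=; congr (_ + _).
  under eq_bigr do under eq_bigr do rewrite [M == _]eq_sym.
  rewrite (@sum_ord_delta_and _ _ M _ (fun m i => pi (m, i) * (k%:R * lambda))
    (fun _ (i : 'I_k) => i0 == i.+1 :> nat)); last by lia.
  have -> : \sum_(m < (M + b).+1) \sum_(i < k) (pi (val m, i) * (k%:R * lambda)) *+
      [&& i.+1 == k, M == m.+1 & i0 == 0%N :> nat] =
    k%:R * lambda * (if i0 == 0%N :> nat
                     then if M is M'.+1 then pi (M', ord_max) else 0 else 0).
    case: (M) => [|M'].
      by rewrite big1 ?if_same ?mulr0// => m _; rewrite big1 // => i _; rewrite andbF.
    under eq_bigr do under eq_bigr do rewrite eqSS [M' == _]eq_sym andbCA.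
    rewrite (@sum_ord_delta_and _ _ M' _ (fun m i => pi (m, i) * (k%:R * lambda))
      (fun _ (i : 'I_k) => (i.+1 == k) && (i0 == 0%N :> nat))); last by lia.
    rewrite (bigD1 ord_max) //= eqxx big1 ?addr0 => [|i].
      by case: ifP => _; rewrite ?mulr0n ?mulr0// mulrC.
    by rewrite -val_eqE /= eqSS => /negbTE ->.
  rewrite /previous_phase; case: ifP => [/eqP i00|i00].
    by rewrite big1 ?add0r// => i _; rewrite i00.
  have i0K : (i0.-1 < K.+1)%N := leq_ltn_trans (leq_pred _) (ltn_ord i0).
  have i0P : i0.-1.+1 = i0 by rewrite prednK// lt0n i00.
  rewrite mulr0 addr0 (bigD1 (inord i0.-1)) //= big1 ?addr0 => [|i].
    by rewrite inordK// i0P eqxx mulr1n mulrC.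
  rewrite -val_eqE /= inordK// => ii.
  have /negbTE -> // : (i0 != i.+1 :> nat).
  by apply: contra ii => /eqP ->.
transitivity (\sum_(m < (M + b).+1 | (0 < m)%N) \sum_(1 <= j < b.+1 | M == (m - j)%N :> nat)
    mu * (p j * pi (val m, i0))).
  rewrite [RHS]big_mkcond; apply: eq_bigr => m _.
  rewrite (bigD1 i0) //= eqxx andbT [X in _ + X]big1 ?addr0 => [|i]; last first.
    by rewrite eq_sym => /negbTE ->; rewrite andbF.
  case: ifP => _; rewrite ?mulr0n ?mulr1n// mulr_sumr.
  by apply: eq_bigr => j _; rewrite mulrC mulrA.
under [LHS]eq_bigr do rewrite big_mkcond /=.
rewrite exchange_big /= mulr_sumr; apply: eq_bigr => j _.
rewrite -big_mkcondr /= !mulr_sumr.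
by apply: eq_bigr.
Qed.

Variable pi : nat * 'I_k -> R.
Hypothesis pi_stat : queue_stationary lambda mu b p pi.

(** At a positive level subtraction is not truncated, so a batch of size [j] comes from the single
    level [M.+1 + j]. *)
Lemma queue_balance_pos (M : nat) (i : 'I_k) :
  (k%:R * lambda + mu) * pi (M.+1, i) =
  k%:R * lambda * previous_phase pi M.+1 i +
  mu * \sum_(1 <= j < b.+1) p j * pi ((M.+1 + j)%N, i).
Proof.
have [pi_ge0 _ /(_ (M.+1, i))] := pi_stat.
rewrite queue_inflow// queue_outflow// => -[]; rewrite mulr1n [in RHS]mulrC => <-.
congr (_ + mu * _); apply: eq_big_nat => j /andP[j1 jb]; congr (_ * _).
have MjM : (M.+1 + j < (M.+1 + b).+1)%N by lia.
rewrite (big_pred1 (Ordinal MjM)) //= => m /=.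
by rewrite -val_eqE /=; lia.
Qed.

(** A batch of size [j] empties each of the levels [1, ..., j]. *)
Lemma queue_balance_zero (i : 'I_k) :
  k%:R * lambda * pi (0%N, i) =
  k%:R * lambda * previous_phase pi 0 i +
  mu * \sum_(1 <= j < b.+1) p j * \sum_(l < j) pi (l.+1, i).
Proof.
have [pi_ge0 _ /(_ (0%N, i))] := pi_stat.
rewrite queue_inflow// queue_outflow// => -[]; rewrite mulr0n addr0 [in RHS]mulrC => <-.
congr (_ + mu * _); apply: eq_big_nat => j /andP[j1 jb]; congr (_ * _).
rewrite add0n big_mkcond big_ord_recl /= add0r -(subnKC (jb : (j <= b)%N)) big_split_ord /=.
rewrite [X in _ + X]big1 ?addr0 => [|l _]; last by rewrite ifF// /bump; lia.
by apply: eq_bigr => l _; rewrite ifT//; have := ltn_ord l; rewrite /= /bump /=; lia.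
Qed.

(** * The stationary distribution in closed form *)

Variable y : R.
Hypothesis y01 : 0 < y < 1.
Hypothesis y_root : mu * crossing b p k y = k%:R * lambda.

Let y_gt0 : 0 < y. Proof. by case/andP: y01. Qed.
Let y_lt1 : y < 1. Proof. by case/andP: y01. Qed.

(** Rearranged, this is the characteristic equation of the recurrence in [linear_stationary_rec]. *)
Lemma root_batch_pgf :
  mu * (y * (1 - batch_pgf b p (y ^+ k))) = (1 - y) * (k%:R * lambda).
Proof. by rewrite -(crossing_geometric p_sum1) -y_root mulrCA. Qed.

Lemma exprk_lt1 : y ^+ k < 1.
Proof. by rewrite exprn_ilt1 ?ltW. Qed.

Lemma root_batch_pgf_lt1 : 0 < 1 - batch_pgf b p (y ^+ k).
Proof.
have : 0 < mu * (y * (1 - batch_pgf b p (y ^+ k))).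
  by rewrite root_batch_pgf !mulr_gt0 ?subr_gt0 ?ltr0n.
by rewrite pmulr_rgt0// pmulr_rgt0.
Qed.

Lemma stationary_sum1 : (\sum_(m <oo) (customers_pmf pi m)%:E = 1)%E.
Proof.
have [pi_ge0 + _] := pi_stat.
rewrite esum_nat_finType => [<-|x]; last by rewrite lee_fin.
by apply: eq_eseriesr => m _; rewrite sumEFin.
Qed.

Lemma customers_pmf_ge0 m : 0 <= customers_pmf pi m.
Proof. by have [pi_ge0 _ _] := pi_stat; exact: sumr_ge0. Qed.

Lemma cvg_series_customers_pmf : series (customers_pmf pi) @ \oo --> (1 : R).
Proof.
exact: eseries_cvg_series customers_pmf_ge0 stationary_sum1.
Qed.

Definition linear_stationary (n : nat) : R := pi ((n %/ k)%N, inord (n %% k)).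

Lemma linear_stationaryE (m : nat) (i : 'I_k) :
  linear_stationary (m * k + i) = pi (m, i).
Proof.
rewrite /linear_stationary divnMDl// divn_small// addn0 modnMDl modn_small//.
by rewrite inord_val.
Qed.

Lemma linear_stationary_cvg0 : linear_stationary @ \oo --> 0.
Proof.
have [pi_ge0 _ _] := pi_stat.
have P0 : customers_pmf pi @ \oo --> 0.
  by apply: cvg_series_cvg_0; apply: cvgP cvg_series_customers_pmf.
apply/cvgr0Pnorm_lt => e e0.
have [M _ small] := (cvgr0Pnorm_lt _).1 P0 _ e0.
exists (M * k)%N => // n /= Mn.
apply: le_lt_trans (small (n %/ k)%N _); last by rewrite /= leq_divRL.
rewrite !ger0_norm ?customers_pmf_ge0 ?pi_ge0// /customers_pmf.
by rewrite (bigD1 (inord (n %% k))) //= lerDl sumr_ge0.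
Qed.

(** In the linear listing, phase completions and arrivals alike move one step up, and a batch of
    size [j] moves [k j] steps down. The bound on [n] excludes level 0, where batches are
    truncated. *)
Lemma linear_stationary_rec (n : nat) : (k <= n.+1)%N ->
  (k%:R * lambda + mu) * linear_stationary n.+1 =
  k%:R * lambda * linear_stationary n +
  mu * \sum_(1 <= j < b.+1) p j * linear_stationary (n.+1 + k * j).
Proof.
move=> kn; have kgt0 : (0 < k)%N by [].
have mk := ltn_pmod n.+1 kgt0.
have : (0 < n.+1 %/ k)%N by rewrite divn_gt0.
have := divn_eq n.+1 k.
case: (n.+1 %/ k)%N (n.+1 %% k)%N mk => // M r rk nE _.
pose i := Ordinal rk.
have -> : linear_stationary n.+1 = pi (M.+1, i) by rewrite nE (linear_stationaryE _ i).
rewrite queue_balance_pos; congr (_ * _ + mu * _).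
  rewrite /previous_phase /=; case: eqP => [r0|/eqP r0].
    have -> : n = (M * k + (ord_max : 'I_k))%N by rewrite /= /k in nE r0 *; lia.
    by rewrite linear_stationaryE.
  have rk1 : (r.-1 < k)%N by lia.
  have -> : n = (M.+1 * k + Ordinal rk1)%N by rewrite /=; lia.
  by rewrite linear_stationaryE; congr (pi (_, _)); apply: val_inj; rewrite /= inordK.
apply: eq_bigr => j _; congr (_ * _).
have -> : (n.+1 + k * j = (M.+1 + j) * k + i)%N by rewrite nE /=; lia.
by rewrite linear_stationaryE.
Qed.

(** The shift by [K = k - 1] puts the last state before the recurrence starts at index 0. The
    difference from the geometric solution with the same initial value satisfies the recurrence and
    tends to 0, hence vanishes. *)
Lemma linear_stationary_geometric (n : nat) :
  linear_stationary (n + K) = pi (0%N, ord_max) * y ^+ n.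
Proof.
pose c := pi (0%N, ord_max : 'I_k).
have cE : linear_stationary K = c by rewrite /c -(linear_stationaryE 0 ord_max).
apply/eqP; rewrite -subr_eq0; apply/eqP.
apply: (@decaying_recurrence_zero R b p p_ge0 p_sum1 (k%:R * lambda) mu k
  (fun n => linear_stationary (n + K) - c * y ^+ n)) => //.
- by rewrite mulr_ge0 ?ler0n ?ltW.
- by rewrite add0n cE expr0 mulr1 subrr.
- rewrite -[0]subr0; apply: cvgB.
    by have := linear_stationary_cvg0; rewrite -(cvg_shiftn K).
  rewrite -[0](mulr0 c); apply: cvgMr => //; apply: cvg_expr.
  by rewrite gtr0_norm.
- move=> m; rewrite addSn mulrBr linear_stationary_rec; last by rewrite ltnS leq_addl.
  have -> : mu * \sum_(1 <= j < b.+1) p j *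
      (linear_stationary (m.+1 + k * j + K) - c * y ^+ (m.+1 + k * j)) =
    mu * \sum_(1 <= j < b.+1) p j * linear_stationary ((m + K).+1 + k * j)
    - mu * (c * y ^+ m.+1 * batch_pgf b p (y ^+ k)).
    rewrite -mulrBr; congr (_ * _); rewrite /batch_pgf mulr_sumr -sumrB.
    apply: eq_bigr => j _; rewrite exprD -exprM -addSn addnAC; ring.
  have yE : (k%:R * lambda + mu) * y = k%:R * lambda + mu * (y * batch_pgf b p (y ^+ k)).
    by have := root_batch_pgf; rewrite !(mulrBr, mulrBl) !mul1r mulr1; lra.
  have -> : (k%:R * lambda + mu) * (c * y ^+ m.+1) = c * y ^+ m * ((k%:R * lambda + mu) * y).
    by rewrite exprS; ring.
  rewrite yE exprS; ring.
Qed.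

Lemma stationary_pos (m : nat) (i : 'I_k) :
  pi (m.+1, i) = pi (0%N, ord_max) * ((y ^+ k) ^+ m * y ^+ i.+1).
Proof.
have -> : pi (m.+1, i) = linear_stationary ((k * m + i.+1) + K).
  by rewrite -linear_stationaryE; congr linear_stationary; rewrite /k; lia.
by rewrite linear_stationary_geometric exprD exprM.
Qed.

Local Notation x := (y ^+ k).

Let x_lt1 : 0 < 1 - x. Proof. by rewrite subr_gt0 exprk_lt1. Qed.
Let x_gt0 : 0 < x. Proof. exact: exprn_gt0. Qed.

(** With the positive levels known, balance at level 0 is a first-order recursion in the phase,
    whose increments [(1 - y) y ^ l] telescope. The factor [1 - x] clears the geometric sums. *)
Lemma stationary_zero (i : 'I_k) :
  (1 - x) * pi (0%N, i) = pi (0%N, ord_max) * (1 - y ^+ i.+1).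
Proof.
set c := pi (0%N, ord_max).
have step (l : 'I_k) :
    (1 - x) * pi (0%N, l) = (1 - x) * previous_phase pi 0 l + c * ((1 - y) * y ^+ l).
  have kl : 0 < k%:R * lambda by rewrite mulr_gt0 ?ltr0n.
  apply: (mulfI (lt0r_neq0 kl)).
  have -> : k%:R * lambda * ((1 - x) * pi (0%N, l)) =
      (1 - x) * (k%:R * lambda * pi (0%N, l)) by ring.
  rewrite queue_balance_zero.
  have -> : \sum_(1 <= j < b.+1) p j * \sum_(m < j) pi (m.+1, l) =
      c * y ^+ l.+1 * \sum_(1 <= j < b.+1) p j * \sum_(m < j) x ^+ m.
    rewrite [RHS]mulr_sumr; apply: eq_bigr => j _.
    under eq_bigr do rewrite stationary_pos -/c.
    rewrite mulrCA; congr (_ * _); rewrite mulr_sumr.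
    by apply: eq_bigr => m _; ring.
  have YE : (1 - x) * \sum_(1 <= j < b.+1) p j * (\sum_(m < j) x ^+ m) =
      1 - batch_pgf b p x.
    rewrite -[X in _ = X - _]p_sum1 /batch_pgf -sumrB mulr_sumr.
    apply: eq_bigr => j _; rewrite mulrCA.
    have xjE : x ^+ j = 1 - (1 - x) * \sum_(m < j) x ^+ m.
      by rewrite -[LHS](subrK 1) subrX1; ring.
    rewrite [in RHS]xjE; ring.
  have -> : (1 - x) * (k%:R * lambda * previous_phase pi 0 l + mu * (c * y ^+ l.+1 *
      \sum_(1 <= j < b.+1) p j * (\sum_(m < j) x ^+ m))) =
    k%:R * lambda * ((1 - x) * previous_phase pi 0 l) + c * y ^+ l * (mu * (y * ((1 - x) *
      \sum_(1 <= j < b.+1) p j * (\sum_(m < j) x ^+ m)))) by rewrite exprS; ring.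
  rewrite YE root_batch_pgf; ring.
case: i => i ik; elim: i ik => [|i IHi] ik.
  by rewrite step /previous_phase /= mulr0 add0r expr0 expr1 mulr1.
have ik' : (i < k)%N by lia.
rewrite step /previous_phase /=.
have -> : inord i = Ordinal ik' by apply: val_inj; rewrite /= inordK.
rewrite IHi /= [y ^+ i.+2]exprS; ring.
Qed.

Lemma customers_pmf_zero_scaled :
  (1 - x) * customers_pmf pi 0 =
  pi (0%N, ord_max) * (k%:R - \sum_(i < k) y ^+ i.+1).
Proof.
rewrite /customers_pmf mulr_sumr; under eq_bigr do rewrite stationary_zero.
by rewrite -mulr_sumr sumrB sumr_const card_ord.
Qed.

(** Normalisation: in the scaled partial sums of the total mass the phase weights [Y] survive only
    in a term with [x ^ n], so comparing limits leaves [c] alone. *)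
Lemma stationary_last_zero : k%:R * pi (0%N, ord_max) = 1 - x.
Proof.
set c := pi (0%N, ord_max); pose Y := \sum_(i < k) y ^+ i.+1.
have partial n : (1 - x) * series (customers_pmf pi) n.+1 = k%:R * c - c * Y * x ^+ n.
  have PS m : customers_pmf pi m.+1 = c * Y * x ^+ m.
    rewrite /customers_pmf; under eq_bigr do rewrite stationary_pos mulrA.
    by rewrite -mulr_sumr -/Y mulrAC.
  rewrite /series /= big_nat_recl// mulrDr customers_pmf_zero_scaled -/c -/Y.
  under eq_bigr do rewrite PS.
  rewrite -mulr_sumr big_mkord.
  have xnE : x ^+ n = 1 - (1 - x) * \sum_(m < n) x ^+ m.
    by rewrite -[LHS](subrK 1) subrX1; ring.
  rewrite xnE; ring.
have lim1 : ((1 - x) * series (customers_pmf pi) n.+1) @[n --> \oo] --> (1 - x) * 1.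
  apply: cvgM; [exact: cvg_cst|have := cvg_series_customers_pmf].
  by rewrite -(cvg_shiftn 1); under eq_fun do rewrite addn1.
have lim2 : ((1 - x) * series (customers_pmf pi) n.+1) @[n --> \oo] --> k%:R * c - c * Y * 0.
  under eq_fun do rewrite partial.
  apply: cvgB; first exact: cvg_cst.
  apply: cvgM; [exact: cvg_cst|apply: cvg_expr].
  by rewrite gtr0_norm ?exprk_lt1.
by have := cvg_unique _ lim1 lim2; rewrite mulr1 mulr0 subr0 => <-.
Qed.

Local Notation L := (mean_level lambda mu b p x).

(** The sum is [y (1 - x) / (1 - y)], and the root equation turns [y / (1 - y)] into [k L]. From
    here on [y] enters only through [x]. *)
Lemma sum_phase_weights : \sum_(i < k) y ^+ i.+1 = k%:R * (L * (1 - x)).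
Proof.
have y1 : 0 < 1 - y by rewrite subr_gt0.
apply: (mulfI (lt0r_neq0 y1)).
have G0 := root_batch_pgf_lt1.
have -> : (1 - y) * (k%:R * (L * (1 - x))) =
    (1 - y) * (k%:R * lambda) * ((1 - x) / (mu * (1 - batch_pgf b p x))).
  by rewrite /mean_level; ring.
rewrite -root_batch_pgf.
under eq_bigr do rewrite exprS.
have -> : 1 - x = (1 - y) * \sum_(i < k) y ^+ i.
  by rewrite -[LHS]opprB subrX1; ring.
rewrite -mulr_sumr; field.
by rewrite !lt0r_neq0.
Qed.

Lemma customers_pmf_pos (m : nat) :
  customers_pmf pi m.+1 = L * (1 - x) ^+ 2 * x ^+ m.
Proof.
rewrite /customers_pmf; under eq_bigr do rewrite stationary_pos mulrA.
rewrite -mulr_sumr sum_phase_weights.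
have -> : pi (0%N, ord_max) * x ^+ m * (k%:R * (L * (1 - x))) =
  k%:R * pi (0%N, ord_max) * (L * (1 - x) * x ^+ m) by ring.
by rewrite stationary_last_zero; ring.
Qed.

Lemma customers_pmf_zero : customers_pmf pi 0 = 1 - L * (1 - x).
Proof.
have k0 : 0 < k%:R :> R by rewrite ltr0n.
apply: (mulfI (lt0r_neq0 x_lt1)); apply: (mulfI (lt0r_neq0 k0)).
rewrite customers_pmf_zero_scaled [LHS]mulrA stationary_last_zero sum_phase_weights.
by ring.
Qed.

Lemma last_phase_geometric (m : nat) :
  last_phase_pmf pi m = (1 - x) / k%:R * x ^+ m.
Proof.
have k0 : 0 < k%:R :> R by rewrite ltr0n.
have -> : (1 - x) / k%:R = pi (0%N, ord_max).
  by rewrite -stationary_last_zero mulrAC mulfV ?mul1r ?lt0r_neq0.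
rewrite /last_phase_pmf (big_pred1 ord_max) => [|i /=]; last by rewrite -val_eqE /= eqSS.
case: m => [|m]; first by rewrite mulr1.
by rewrite stationary_pos [in RHS]exprSr.
Qed.

(** The last phase has total mass [1 / k], by which the conditioning divides. *)
Lemma arrival_geometric (m : nat) : arrival_pmf pi m = (1 - x) * x ^+ m.
Proof.
have k0 : 0 < k%:R :> R by rewrite ltr0n.
rewrite /arrival_pmf (@cvg_series_eseries _ _ k%:R^-1) => [|/=].
  by rewrite last_phase_geometric /=; field; rewrite lt0r_neq0.
have -> : last_phase_pmf pi = geometric ((1 - x) / k%:R) x.
  by apply/funext => n; rewrite last_phase_geometric.
have {2}-> : k%:R^-1 = (1 - x) / k%:R / (1 - x) by field; rewrite !lt0r_neq0.
by apply: cvg_geometric_series; rewrite gtr0_norm// -subr_gt0.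
Qed.
End Balance.

(** * Mean and variance of a geometric law with modified mass at zero *)

Section GeometricMoments.
Variables (R : realType) (x : R).
Hypothesis x01 : 0 <= x < 1.

Let x_ge0 : 0 <= x. Proof. by case/andP: x01. Qed.
Let x_lt1 : 0 < 1 - x. Proof. by rewrite subr_gt0; case/andP: x01. Qed.

(** These are the terms of a convergent series: its partial sums increase and are bounded through a
    closed form. *)
Lemma cvg_quadratic_geometric :
  (n.+1%:R * n.+2%:R * x ^+ n) @[n --> \oo] --> (0 : R).
Proof.
pose u n : R := n.+1%:R * n.+2%:R * x ^+ n.
have u_ge0 n : 0 <= u n by rewrite !mulr_ge0 ?ler0n ?exprn_ge0.
apply: (@cvg_series_cvg_0 _ _ u); apply: nondecreasing_is_cvgn.
  by apply/nondecreasing_seqP => n; rewrite /series /= big_nat_recr//= lerDl.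
(* [x ^+ n * q n / (1 - x) ^+ 3] is the tail of the series from [n] on. *)
pose q n : R := n.+1%:R * n.+2%:R * (1 - x) ^+ 2 + 2 * n.+2%:R * x * (1 - x) + 2 * x ^+ 2.
have uq n : (1 - x) ^+ 3 * series u n = q 0%N - x ^+ n * q n.
  elim: n => [|n IHn]; first by rewrite /series /= big_geq// mulr0 expr0 mul1r subrr.
  rewrite /series /= big_nat_recr//= mulrDr -[\sum_(_ <= _ < _) _]/(series u n) IHn.
  move: (q 0%N) => q0; rewrite /q /u -[n.+3%:R]natr1 -[n.+2%:R]natr1 -[n.+1%:R]natr1.
  rewrite [x ^+ n.+1]exprS; ring.
exists (q 0%N / (1 - x) ^+ 3) => _ [n _ <-].
rewrite ler_pdivlMr ?exprn_gt0// mulrC uq gerBl mulr_ge0 ?exprn_ge0//.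
by rewrite /q !addr_ge0 // !mulr_ge0 ?ler0n ?exprn_ge0 // ltW.
Qed.

Lemma cvg_linear_geometric : (n.+1%:R * x ^+ n) @[n --> \oo] --> (0 : R).
Proof.
apply: (squeeze_cvgr _ (cvg_cst 0) cvg_quadratic_geometric).
apply: nearW => n; rewrite mulr_ge0 ?ler0n ?exprn_ge0//=.
by rewrite ler_wpM2r ?exprn_ge0// ler_peMr ?ler0n// ler1n.
Qed.

Let cvg_x : x ^+ n @[n --> \oo] --> (0 : R).
Proof. by apply: cvg_expr; rewrite ger0_norm//; case/andP: x01. Qed.

Variables (L : R) (P : nat -> R).
Hypothesis P0 : P 0%N = 1 - L * (1 - x).
Hypothesis PS : forall m, P m.+1 = L * (1 - x) ^+ 2 * x ^+ m.

Lemma mean_modified_geometric : (\sum_(m <oo) (m%:R * P m)%:E = L%:E)%E.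
Proof.
apply: cvg_series_eseries; rewrite -(cvg_shiftn 1) /=.
(* The subtracted part is the tail of the series from [m = n + 1] on. *)
have partial n : series (fun m => m%:R * P m) (n + 1)%N =
    L - L * ((1 - x) * (n.+1%:R * x ^+ n) + x * x ^+ n).
  rewrite addn1; elim: n => [|n IHn].
    by rewrite /series /= big_nat1 mul0r expr0; ring.
  rewrite /series /= big_nat_recr//=.
  rewrite -[\sum_(_ <= _ < _) _]/(series (fun m => m%:R * P m) n.+1) IHn.
  rewrite PS -[n.+2%:R]natr1 [x ^+ n.+1]exprS; ring.
under eq_fun do rewrite partial.
suff : (L - L * ((1 - x) * (n.+1%:R * x ^+ n) + x * x ^+ n)) @[n --> \oo] -->
    L - L * ((1 - x) * 0 + x * 0) by rewrite !mulr0 addr0 mulr0 subr0.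
apply: cvgB; first exact: cvg_cst.
apply: cvgM; first exact: cvg_cst.
by apply: cvgD; apply: cvgM; [exact: cvg_cst|exact: cvg_linear_geometric|exact: cvg_cst|].
Qed.

Lemma variance_modified_geometric :
  (\sum_(m <oo) ((m%:R - L) ^+ 2 * P m)%:E = (L * ((1 + x) / (1 - x) - L))%:E)%E.
Proof.
apply: cvg_series_eseries; rewrite -(cvg_shiftn 1) /=.
(* [A], [B], [C] are the coefficients of the tail from [m = n + 1] on, in the basis
   [(n + 1) (n + 2)], [n + 1], [1]; [VE] is the case [n = 0]. *)
pose A := (1 - x) ^+ 2; pose B := 2 * x * (1 - x) - (1 + 2 * L) * (1 - x) ^+ 2.
pose C := (1 - x) ^+ 2 * L ^+ 2 - 2 * L * x * (1 - x) + x * (1 + x).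
pose V := L * ((1 + x) / (1 - x) - L).
have VE : L ^+ 2 * (1 - L * (1 - x)) = V - L / (1 - x) * (2 * A + B + C).
  by rewrite /V /A /B /C; field; rewrite lt0r_neq0.
have partial n : series (fun m => (m%:R - L) ^+ 2 * P m) (n + 1)%N =
    V - L / (1 - x) * (A * (n.+1%:R * n.+2%:R * x ^+ n) + B * (n.+1%:R * x ^+ n) + C * x ^+ n).
  rewrite addn1; elim: n => [|n IHn].
    rewrite /series /= big_nat1 P0 !expr0 !mulr1 mul1r [2 * A]mulrC in VE *.
    by rewrite mulrC sub0r sqrrN mulrC VE.
  rewrite /series /= big_nat_recr//=.
  rewrite -[\sum_(_ <= _ < _) _]/(series (fun m => (m%:R - L) ^+ 2 * P m) n.+1) IHn.
  rewrite PS -[n.+3%:R]natr1 -[n.+2%:R]natr1 -[n.+1%:R]natr1 [x ^+ n.+1]exprS /A /B /C; field.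
  by rewrite lt0r_neq0.
under eq_fun do rewrite partial.
suff : (V - L / (1 - x) * (A * (n.+1%:R * n.+2%:R * x ^+ n) + B * (n.+1%:R * x ^+ n) +
    C * x ^+ n)) @[n --> \oo] --> V - L / (1 - x) * (A * 0 + B * 0 + C * 0).
  by rewrite !mulr0 !addr0 mulr0 subr0.
apply: cvgB; first exact: cvg_cst.
apply: cvgM; first exact: cvg_cst.
apply: cvgD; first apply: cvgD; apply: cvgM; try exact: cvg_cst.
- exact: cvg_quadratic_geometric.
- exact: cvg_linear_geometric.
- exact: cvg_x.
Qed.

End GeometricMoments.

(** * Monotonicity in the ratio [x] *)

Section Monotonicity.
Variables (R : realType) (lambda mu : R) (b : nat) (p : nat -> R).
Hypotheses (lambda_gt0 : 0 < lambda) (mu_gt0 : 0 < mu).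
Hypothesis p_ge0 : forall j, (1 <= j <= b)%N -> 0 <= p j.
Hypothesis p_sum1 : \sum_(1 <= j < b.+1) p j = 1.
Variables x x' : R.
Hypotheses (x'_ge0 : 0 <= x') (x'_le : x' <= x) (x_lt1 : x < 1).
Hypothesis Y_lt1 : 0 < 1 - batch_pgf b p x.

Local Notation L := (mean_level lambda mu b p).

Let Y'_lt1 : 0 < 1 - batch_pgf b p x'.
Proof.
by apply: lt_le_trans Y_lt1 _; rewrite lerD2l lerN2 le_batch_pgf// x'_ge0.
Qed.

Lemma mean_level_gt0 : 0 < L x.
Proof. by rewrite divr_gt0 ?mulr_gt0. Qed.

Lemma le_mean_level : L x' <= L x.
Proof.
rewrite ler_pM2l// lef_pV2 ?posrE ?mulr_gt0// ler_pM2l//.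
by rewrite lerD2l lerN2 le_batch_pgf// x'_ge0.
Qed.

(** [L (1 - x)] is the probability of a nonempty system. The factor [1 - x] cancels against
    [1 - Y(x)] and leaves in the denominator a polynomial with nonnegative coefficients. *)
Lemma ge_busy_probability : L x * (1 - x) <= L x' * (1 - x').
Proof.
pose S z := \sum_(1 <= j < b.+1) p j * \sum_(i < j) z ^+ i.
have YE z : 1 - batch_pgf b p z = (1 - z) * S z.
  rewrite -[X in X - _ = _]p_sum1 /batch_pgf -sumrB mulr_sumr.
  apply: eq_bigr => j _.
  have -> : z ^+ j = 1 - (1 - z) * \sum_(m < j) z ^+ m.
    by rewrite -[LHS](subrK 1) subrX1; ring.
  ring.
have SE z : z < 1 -> 0 < 1 - batch_pgf b p z ->
    0 < S z /\ L z * (1 - z) = lambda / (mu * S z).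
  move=> z1; rewrite /mean_level YE pmulr_rgt0 ?subr_gt0// => S0; split => //.
  by field; rewrite !lt0r_neq0 ?subr_gt0.
have [S0 ->] := SE x x_lt1 Y_lt1.
have [S'0 ->] := SE x' (le_lt_trans x'_le x_lt1) Y'_lt1.
rewrite ler_pM2l// lef_pV2 ?posrE ?mulr_gt0// ler_pM2l//.
apply: ler_sum_batch => // j _; apply: ler_sum => i _.
by apply: lerXn2r; rewrite ?nnegrE ?(le_trans x'_ge0).
Qed.
End Monotonicity.

(** Two opposite monotonicities meet: the mean grows with the ratio while the probability
    [L (1 - x)] of a nonempty system falls, which limits the growth of the mean. *)
Lemma le_modified_geometric_variance (R : realType) (x x' L L' : R) :
  0 <= x' -> x' <= x -> x < 1 -> 0 < L -> L' <= L ->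
  L * (1 - x) <= L' * (1 - x') -> L' * (1 - x') <= 1 ->
  L' * ((1 + x') / (1 - x') - L') <= L * ((1 + x) / (1 - x) - L).
Proof.
move=> x'0 x'x x1 L0 L'L g g1.
have X : 0 < 1 - x by lra.
have X' : 0 < 1 - x' by lra.
pose u := (1 - x)^-1; pose u' := (1 - x')^-1.
(* The difference of the variances is
   [2 L (u - u') + (L - L') (2 u' - 1 - L - L')], whose second summand is at
   least [- (L - L') u], hence at least [- L (u - u')]. *)
have -> : (1 + x) / (1 - x) = 2 * u - 1 by rewrite /u; field; rewrite lt0r_neq0.
have -> : (1 + x') / (1 - x') = 2 * u' - 1 by rewrite /u'; field; rewrite lt0r_neq0.
have u'1 : 1 <= u' by rewrite invf_ge1//; lra.
have uu' : u' <= u by rewrite lef_pV2 ?posrE//; lra.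
have Lu : L <= u by rewrite -[u]mul1r ler_pdivlMr//; lra.
have L'u' : L' <= u' by rewrite -[u']mul1r ler_pdivlMr.
(* This is [g] after multiplication by [u u']. *)
have dL : (L - L') * u <= L * (u - u').
  suff : L * u' <= L' * u by lra.
  rewrite ler_pdivlMr// mulrAC ler_pdivrMr//.
have : (L - L') * (1 + L + L' - 2 * u') <= (L - L') * u by apply: ler_wpM2l; lra.
have : 0 <= L * (u - u') by rewrite mulr_ge0; lra.
nra.
Qed.

(** * The mean sojourn time of a tagged customer *)

Section Sojourn.
Variables (R : realType) (mu : R) (b : nat) (p : nat -> R) (k : nat).
Variable pi : nat * 'I_k -> R.
Hypothesis mu_gt0 : 0 < mu.
Hypothesis p_ge0 : forall j, (1 <= j <= b)%N -> 0 <= p j.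
Hypothesis p_sum1 : \sum_(1 <= j < b.+1) p j = 1.
Variable C : tagged_customer mu b p pi.

Local Notation P := (tagged_prob C).

Definition batch_weight (j : nat) : R := p j *+ (1 <= j <= b)%N.

Lemma batch_weight_ge0 j : 0 <= batch_weight j.
Proof. by rewrite /batch_weight mulrb; case: ifP => // /p_ge0. Qed.

Lemma sum_batch_weight : \sum_(j < b.+1) batch_weight j = 1.
Proof.
rewrite big_ord_recl /batch_weight mulr0n add0r -p_sum1 big_add1 big_mkord.
by apply: eq_bigr => j _; rewrite /= /bump /= add1n ltn_ord mulr1n.
Qed.

Definition present (i : nat) : set (tagged_space C) :=
  [set w | (\sum_(l < i) batch C l w <= found C w)%N].

Lemma measurable_found (m : nat) : measurable [set w | found C w = m].
Proof.
rewrite -[X in measurable X]setTI.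
exact: (measurable_funP (found C) measurableT [set m]).
Qed.

Lemma measurable_batch (l j : nat) : measurable [set w | batch C l w = j].
Proof.
rewrite -[X in measurable X]setTI.
exact: (measurable_funP (batch C l) measurableT [set j]).
Qed.

Lemma measurable_service (l : nat) (B : set R) : measurable B ->
  measurable (service C l @^-1` B).
Proof.
move=> mB; rewrite -[X in measurable X]setTI.
exact: (measurable_funP (service C l)).
Qed.

Lemma measurable_present (i : nat) : measurable (present i).
Proof.
have ms : measurable_fun setT (fun w => \sum_(l < i) batch C l w)%N.
  elim: i => [|i IHi].
    by under eq_fun do rewrite big_ord0; exact: measurable_cst.
  under eq_fun do rewrite big_ord_recr /=.
  by apply: measurable_fun_addn.
rewrite -[X in measurable X]setTI.
have mle := measurable_fun_leq ms (measurable_funP (found C)).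
rewrite [X in _ `&` X](_ : _ =
    (fun w => (\sum_(l < i) batch C l w <= found C w)%N) @^-1` [set true]).
  exact: mle.
by apply/seteqP; split.
Qed.

Definition batch_run (i : nat) (f : {ffun 'I_i.+1 -> 'I_b.+1}) : R :=
  \prod_(l < i.+1) batch_weight (f l).

Lemma tagged_run (i m : nat) (f : {ffun 'I_i.+1 -> 'I_b.+1}) (B : set R) :
  measurable B ->
  P [set w | found C w = m /\ (forall l : 'I_i.+1, batch C l w = f l)
             /\ B (service C i w)]
  = (arrival_pmf pi m * (batch_run f * fine (exponential_prob mu B)))%:E.
Proof.
(* Only service [i] is constrained; the others range over the whole line, of exponential mass 1. *)
move=> mB; pose A l : set R := if l == i then B else setT.
have mA l : measurable (A l) by rewrite /A; case: ifP.
have := @tagged_law _ _ _ _ _ _ C i.+1 m (fun l => f (inord l)) A mA.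
have -> : \prod_(l < i.+1) (p (f (inord l)) *+ (1 <= f (inord l) <= b)%N *
    fine (exponential_prob mu (A l))) = batch_run f * fine (exponential_prob mu B).
  rewrite big_split /=; congr (_ * _).
    by rewrite /batch_run /batch_weight; apply: eq_bigr => l _; rewrite inord_val.
  rewrite (bigD1 ord_max) //= /A eqxx big1 ?mulr1 // => l.
  rewrite -val_eqE /= => /negbTE ->.
  by rewrite /exponential_prob integral_exponential_pdf.
move=> <-; congr (P _); apply/seteqP; split => w /=.
  move=> [-> [fl Bs]]; split=> // l li; split.
    by have := fl (inord l); rewrite inordK.
  by rewrite /A; case: eqP => // ->.
move=> [-> H]; split=> //; split=> [l|].
  by have [] := H l (ltn_ord l); rewrite inord_val.
by have [_] := H i (ltnSn i); rewrite /A eqxx.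
Qed.

(** Whether service [i] is needed depends on the batches before it. Batch [i] belongs to the run
    because [tagged_law] gives batches and services the same index range. *)
Definition run_total (i : nat) (f : {ffun 'I_i.+1 -> 'I_b.+1}) : nat :=
  \sum_(l < i) f (widen_ord (leqnSn i) l).

Lemma tagged_found (m : nat) : P [set w | found C w = m] = (arrival_pmf pi m)%:E.
Proof.
have := @tagged_law _ _ _ _ _ _ C 0%N m (fun=> 0%N) (fun=> setT) (fun=> measurableT).
rewrite big_ord0 mulr1 => <-; congr (P _).
by apply/seteqP; split => w /= => [->|[]].
Qed.

Lemma measurable_run (i m : nat) (f : {ffun 'I_i.+1 -> 'I_b.+1}) :
  measurable [set w | found C w = m /\ forall l : 'I_i.+1, batch C l w = f l].
Proof.
have -> : [set w | found C w = m /\ forall l : 'I_i.+1, batch C l w = f l] =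
    [set w | found C w = m] `&` \bigcap_(l in [set: 'I_i.+1]) [set w | batch C l w = f l].
  apply/seteqP; split => w /= [-> H]; split => // l; first by move=> _; exact: H.
  exact: (H l I).
apply: measurableI; first exact: measurable_found.
by apply: fin_bigcap_measurable => // l _; exact: measurable_batch.
Qed.

Lemma sum_batch_run (i : nat) : \sum_(f : {ffun 'I_i.+1 -> 'I_b.+1}) batch_run f = 1.
Proof.
rewrite /batch_run -(bigA_distr_bigA (fun _ (j : 'I_b.+1) => batch_weight j)).
by rewrite big1 // => l _; exact: sum_batch_weight.
Qed.

Lemma measure_finType_bigcup d (T : measurableType d) (Q : probability T R)
    (J : finType) (F : J -> set T) : trivIset setT F ->
  (forall f, measurable (F f)) -> Q (\bigcup_f F f) = (\sum_f Q (F f))%E.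
Proof.
move=> tF mF; rewrite measure_fin_bigcup//; last exact: finite_finset.
exact: fsbig_finType.
Qed.

Lemma tagged_present_found (i m : nat) (B : set R) : measurable B ->
  P ([set w | found C w = m] `&` (present i `&` service C i @^-1` B)) =
  (\sum_(f : {ffun 'I_i.+1 -> 'I_b.+1}) (if (run_total f <= m)%N then
     arrival_pmf pi m * (batch_run f * fine (exponential_prob mu B)) else 0)%:E)%E.
Proof.
move=> mB; set D := _ `&` _.
pose E (f : {ffun 'I_i.+1 -> 'I_b.+1}) :=
  [set w | found C w = m /\ forall l : 'I_i.+1, batch C l w = f l].
have mD : measurable D.
  apply: measurableI; first exact: measurable_found.
  by apply: measurableI; [exact: measurable_present|exact: measurable_service].
have mE f : measurable (E f) by exact: measurable_run.
have tE : trivIset setT E.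
  apply/trivIsetP => f g _ _ /eqP fg; rewrite -subset0 => w [[_ Hf] [_ Hg]].
  by apply: fg; apply/ffunP => l; apply: val_inj; rewrite /= -Hf -Hg.
have mU : measurable (\bigcup_f E f) by apply: fin_bigcup_measurable.
have PE f : P (E f) = (arrival_pmf pi m * batch_run f)%:E.
  have := @tagged_run i m f setT measurableT.
  have -> : fine (exponential_prob mu setT) = 1.
    by rewrite /exponential_prob integral_exponential_pdf.
  rewrite mulr1 => <-; congr (P _).
  by apply/seteqP; split => w /= [fw H]; split => //; case: H.
(* Batches are [nat]-valued, so the runs miss outcomes with a batch above [b]; these are negligible
   because the masses of the [E f] add up to that of [found = m]. *)
have PU : P ([set w | found C w = m] `\` \bigcup_f E f) = 0%E.
  rewrite measureD//=; last 2 first.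
  - exact: measurable_found.
  - by rewrite tagged_found ltry.
  have -> : [set w | found C w = m] `&` \bigcup_f E f = \bigcup_f E f.
    by apply/setIidPr => w [f _ []].
  rewrite measure_finType_bigcup// tagged_found.
  under eq_bigr do rewrite PE.
  by rewrite sumEFin -mulr_sumr sum_batch_run mulr1 -EFinB subrr.
have -> : P D = P (D `&` \bigcup_f E f).
  rewrite (measureDI P mD mU) [X in (X + _)%E](_ : _ = 0%E) ?add0e//.
  apply: subset_measure0 PU => //.
  - exact: measurableD.
  - by apply: measurableD => //; exact: measurable_found.
  - by apply: setSD => w [].
rewrite setI_bigcupr measure_finType_bigcup; last 2 first.
- exact: trivIset_setIl.
- by move=> f; exact: measurableI.
apply: eq_bigr => f _.
have total w : E f w -> (\sum_(l < i) batch C l w)%N = run_total f.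
  move=> [_ H]; apply: eq_bigr => l _.
  exact: (H (widen_ord (leqnSn i) l)).
case: ifPn => fm.
  rewrite -tagged_run//; congr (P _); apply/seteqP; split => w /=.
    by move=> [[_ [_ Bw]] [fw bw]].
  move=> [fw [bw Bw]]; split; last by [].
  by split=> //; split=> //; rewrite /present /= total// fw.
rewrite (_ : D `&` E f = set0) ?measure0//.
rewrite -subset0 => w [[fw [pw _]] Ew].
by move: pw fm; rewrite /present /= total// fw => ->.
Qed.

Variable x : R.
Hypothesis x01 : 0 <= x < 1.
Hypothesis arrivalE : forall m, arrival_pmf pi m = (1 - x) * x ^+ m.

(** A geometric [found] reaches a total [s] with probability [x ^ s], so this is the generating
    function at [x] of the total of the first [i] batches, that is [Y(x) ^ i]. *)
Definition present_probability (i : nat) : R :=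
  \sum_(f : {ffun 'I_i.+1 -> 'I_b.+1}) batch_run f * x ^+ run_total f.

Lemma geometric_tail (s : nat) (c : R) :
  (\sum_(m <oo) (if (s <= m)%N then (1 - x) * x ^+ m * c else 0)%:E = (c * x ^+ s)%:E)%E.
Proof.
apply: cvg_series_eseries; rewrite -(cvg_shiftn s) /=.
have partial n : series (fun m => if (s <= m)%N then (1 - x) * x ^+ m * c else 0) (n + s)%N =
    c * x ^+ s - c * x ^+ s * x ^+ n.
  elim: n => [|n IHn].
    rewrite add0n expr0 mulr1 subrr /series /= big_nat big1 // => l /andP[_ ls].
    by rewrite leqNgt ls.
  rewrite addSn /series /= big_nat_recr//= -[\sum_(_ <= _ < _) _]/(series _ (n + s)%N) IHn.
  rewrite leq_addl exprD exprS; ring.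
under eq_fun do rewrite partial.
suff : (c * x ^+ s - c * x ^+ s * x ^+ n) @[n --> \oo] --> c * x ^+ s - c * x ^+ s * 0.
  by rewrite mulr0 subr0.
apply: cvgB; first exact: cvg_cst.
apply: cvgM; first exact: cvg_cst.
by case/andP: x01 => x0 x1; apply: cvg_expr; rewrite ger0_norm.
Qed.

(** Summation over [m] turns each run into a geometric tail. The product form says that the duration
    of service [i] is independent of whether that service is needed. *)
Lemma tagged_present (i : nat) (B : set R) : measurable B ->
  P (present i `&` service C i @^-1` B) =
  (present_probability i * fine (exponential_prob mu B))%:E.
Proof.
move=> mB; set D := _ `&` _.
have mD : measurable D.
  by apply: measurableI; [exact: measurable_present|exact: measurable_service].
have -> : D = \bigcup_m ([set w | found C w = m] `&` D).
  by apply/seteqP; split => [w Dw|w [m _ []]//]; exists (found C w).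
rewrite measure_semi_bigcup; last 3 first.
- by move=> m; apply: measurableI => //; exact: measurable_found.
- apply/trivIsetP => m n _ _ /eqP mn; rewrite -subset0 => w [[fm _] [fn _]].
  by apply: mn; rewrite -fm -fn.
- by apply: bigcup_measurable => m _; apply: measurableI => //; exact: measurable_found.
have e0 : 0 <= fine (exponential_prob mu B).
  apply: fine_ge0; apply: integral_ge0 => t _.
  by rewrite lee_fin exponential_pdf_ge0// ltW.
have x0 : 0 <= x by case/andP: x01.
have x1 : 0 <= 1 - x by case/andP: x01 => _ /ltW; rewrite subr_ge0.
have run0 f : 0 <= batch_run f :> R by apply: prodr_ge0 => l _; exact: batch_weight_ge0.
transitivity (\sum_(m <oo) \sum_(f : {ffun 'I_i.+1 -> 'I_b.+1}) (if (run_total f <= m)%N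
    then (1 - x) * x ^+ m * (batch_run f * fine (exponential_prob mu B)) else 0)%:E)%E.
  apply: eq_eseriesr => m _; apply: etrans (tagged_present_found i m mB) _.
  by under eq_bigr do rewrite arrivalE.
rewrite nneseries_sum => [|f m _]; last first.
  by rewrite lee_fin; case: ifP => // _; rewrite !mulr_ge0 ?exprn_ge0.
under eq_bigr do rewrite geometric_tail.
rewrite sumEFin /present_probability mulr_suml; congr (_%:E).
by apply: eq_bigr => f _; ring.
Qed.

Lemma present_probability0 : present_probability 0 = 1.
Proof.
rewrite -(sum_batch_run 0); apply: eq_bigr => f _.
by rewrite /run_total big_ord0 expr0 mulr1.
Qed.

(** Service 0 is always needed, so [tagged_present] at [i = 0] gives its law. *)
Lemma service_law (B : set R) : measurable B ->
  distribution P (service C 0) B = (fine (exponential_prob mu B))%:E.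
Proof.
move=> mB; rewrite -[fine _]mul1r -present_probability0 -tagged_present//.
congr (P _); apply/seteqP; split => w; last by case.
by move=> Bw; split => //; rewrite /present /= big_ord0.
Qed.

(* Leaving out [0] loses nothing and allows for time slices that vanish because
   the customer has left. *)
Definition service_mean : \bar R :=
  (\int[distribution P (service C 0)]_(t in ~` [set 0%R]) `|t|%:E)%E.

Lemma present_probability_ge0 (i : nat) : 0 <= present_probability i.
Proof.
have x0 : 0 <= x by case/andP: x01.
apply: sumr_ge0 => f _; rewrite mulr_ge0 ?exprn_ge0//.
by apply: prodr_ge0 => l _; exact: batch_weight_ge0.
Qed.

Let time_slice (i : nat) (w : tagged_space C) : R :=
  service C i w *+ (\sum_(l < i) batch C l w <= found C w)%N.

Lemma measurable_time_slice (i : nat) : measurable_fun setT (time_slice i).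
Proof.
have -> : time_slice i = service C i \* \1_(present i).
  apply/funext => w; rewrite /time_slice /= indicE.
  case: (boolP (_ <= _)%N) => H; first by rewrite mem_set// mulr1.
  by rewrite memNset ?mulr0//; exact/negP.
apply: measurable_funM; first exact: measurable_funP.
by apply: measurable_indic; exact: measurable_present.
Qed.

(** On sets avoiding 0 the law of the time slice is [present_probability i] times the law of service
    0: a nonzero slice forces presence. The absolute value keeps the integrand nonnegative on the
    whole line. *)
Lemma mean_time_slice (i : nat) :
  (\int[P]_w (time_slice i w)%:E = (present_probability i)%:E * service_mean)%E.
Proof.
have mg := measurable_time_slice i.
pose D : set R := ~` [set 0].
have mD : measurable D by apply: measurableC; exact: measurable_set1.
pose a : {nonneg R} := NngNum (present_probability_ge0 i).
have mabs : measurable_fun D (fun t : R => `|t|%:E).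
  apply/measurable_EFinP; exact: measurable_funTS.
transitivity (\int[pushforward P (time_slice i)]_(t in D) `|t|%:E)%E.
  rewrite ge0_integral_pushforward//.
  rewrite [RHS]integral_mkcond; apply: eq_integral => w _.
  rewrite patchE; case: ifPn => /=.
    by move=> _; rewrite ger0_norm// mulrn_wge0// service_ge0.
  by rewrite notin_setE /D /= => /contrapT ->.
transitivity (\int[mscale a (distribution P (service C 0))]_(t in D) `|t|%:E)%E; last first.
  by rewrite ge0_integral_mscale.
apply: eq_measure_integral => A mA AD.
rewrite /= /mscale /pushforward /=.
have -> : time_slice i @^-1` A = present i `&` service C i @^-1` A.
  apply/seteqP; split => w.
    rewrite /preimage /= /time_slice /present /=.
    by case: (_ <= _)%N => A0; [split|case: (AD _ A0)].
  by rewrite /preimage /present /= /time_slice => -[->].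
rewrite tagged_present// EFinM; congr (_ * _)%E.
by rewrite -service_law.
Qed.

Lemma mean_sojournE :
  (mean_sojourn C = \sum_(i <oo) (present_probability i)%:E * service_mean)%E.
Proof.
rewrite /mean_sojourn /sojourn_time integral_nneseries//.
- by apply: eq_eseriesr => i _; exact: mean_time_slice.
- by move=> i; apply/measurable_EFinP; exact: measurable_time_slice.
- by move=> i w _; rewrite lee_fin mulrn_wge0// service_ge0.
Qed.

End Sojourn.

(** * Comparison of consecutive queues *)

Lemma service_mean_eq (R : realType) (mu : R) (b : nat) (p : nat -> R) (mu_gt0 : 0 < mu)
    (p_ge0 : forall j, (1 <= j <= b)%N -> 0 <= p j)
    (p_sum1 : \sum_(1 <= j < b.+1) p j = 1) (k k' : nat)
    (pi : nat * 'I_k -> R) (pi' : nat * 'I_k' -> R)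
    (C : tagged_customer mu b p pi) (C' : tagged_customer mu b p pi') (x x' : R) :
  0 <= x < 1 -> 0 <= x' < 1 ->
  (forall m, arrival_pmf pi m = (1 - x) * x ^+ m) ->
  (forall m, arrival_pmf pi' m = (1 - x') * x' ^+ m) ->
  service_mean C = service_mean C'.
Proof.
move=> x01 x'01 xE x'E; apply: eq_measure_integral => A mA _.
exact: etrans (service_law mu_gt0 p_ge0 p_sum1 C x01 xE mA)
  (esym (service_law mu_gt0 p_ge0 p_sum1 C' x'01 x'E mA)).
Qed.

Lemma le_present_probability (R : realType) (b : nat) (p : nat -> R)
    (p_ge0 : forall j, (1 <= j <= b)%N -> 0 <= p j) (x x' : R) (i : nat) :
  0 <= x' <= x -> present_probability b p x' i <= present_probability b p x i.
Proof.
move=> /andP[x'0 x'x]; apply: ler_sum => f _; apply: ler_wpM2l.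
  by apply: prodr_ge0 => l _; exact: batch_weight_ge0.
by apply: lerXn2r; rewrite ?nnegrE ?(le_trans x'0).
Qed.

Lemma mean_customersE (R : realType) (lambda mu : R) (b : nat) (p : nat -> R) (K : nat)
    (lambda_gt0 : 0 < lambda) (mu_gt0 : 0 < mu)
    (p_ge0 : forall j, (1 <= j <= b)%N -> 0 <= p j)
    (p_sum1 : \sum_(1 <= j < b.+1) p j = 1) (pi : nat * 'I_K.+1 -> R)
    (pi_stat : queue_stationary lambda mu b p pi) (y : R) :
  0 < y < 1 -> mu * crossing b p K.+1 y = K.+1%:R * lambda ->
  mean_customers pi = (mean_level lambda mu b p (y ^+ K.+1))%:E.
Proof.
move=> y01 root; have /andP[y0 y1] := y01.
apply: (@mean_modified_geometric _ (y ^+ K.+1)).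
- by rewrite exprn_ge0 ?ltW//= exprk_lt1.
- exact: customers_pmf_pos root.
Qed.

Lemma variance_customersE (R : realType) (lambda mu : R) (b : nat) (p : nat -> R) (K : nat)
    (lambda_gt0 : 0 < lambda) (mu_gt0 : 0 < mu)
    (p_ge0 : forall j, (1 <= j <= b)%N -> 0 <= p j)
    (p_sum1 : \sum_(1 <= j < b.+1) p j = 1) (pi : nat * 'I_K.+1 -> R)
    (pi_stat : queue_stationary lambda mu b p pi) (y : R) :
  0 < y < 1 -> mu * crossing b p K.+1 y = K.+1%:R * lambda ->
  variance_customers pi =
  (let x := y ^+ K.+1 in let L := mean_level lambda mu b p x in
   L * ((1 + x) / (1 - x) - L))%:E.
Proof.
move=> y01 root; have /andP[y0 y1] := y01.
rewrite /variance_customers (mean_customersE lambda_gt0 mu_gt0 p_ge0 p_sum1 pi_stat y01 root) /=.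
apply: (@variance_modified_geometric _ (y ^+ K.+1)).
- by rewrite exprn_ge0 ?ltW//= exprk_lt1.
- exact: customers_pmf_zero root.
- exact: customers_pmf_pos root.
Qed.

Theorem theorem5p2 (R : realType) (lambda mu : R) (b : nat) (p : nat -> R)
    (lambda_gt0 : 0 < lambda) (mu_gt0 : 0 < mu)
    (p_ge0 : forall j, (1 <= j <= b)%N -> 0 <= p j)
    (p_sum1 : \sum_(1 <= j < b.+1) p j = 1)
    (ergodic : lambda < mu * \sum_(1 <= j < b.+1) j%:R * p j)
    (k : nat) (k_ge1 : (1 <= k)%N)
    (pi : nat * 'I_k -> R) (pi' : nat * 'I_k.+1 -> R)
    (pi_stat : queue_stationary lambda mu b p pi)
    (pi'_stat : queue_stationary lambda mu b p pi')
    (C : tagged_customer mu b p pi) (C' : tagged_customer mu b p pi') :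
  [/\ (mean_customers pi' <= mean_customers pi)%E,
      (mean_sojourn C' <= mean_sojourn C)%E
    & (variance_customers pi' <= variance_customers pi)%E].
Proof.
case: k k_ge1 => // K _ in pi pi' pi_stat pi'_stat C C' *.
have [y y01 root] := crossing_root lambda_gt0 mu_gt0 ergodic (ltn0Sn K).
have [y' y'01 root'] := crossing_root lambda_gt0 mu_gt0 ergodic (ltn0Sn K.+1).
(* The two queues are compared through their ratios; the rest is monotonicity in [x]. *)
have le_x := crossing_root_decreasing p_ge0 p_sum1 mu_gt0 (ltn0Sn K) y01 y'01 root root'.
have [/andP[y0 y1] /andP[y'0 y'1]] := (y01, y'01).
have Y_lt1 := root_batch_pgf_lt1 lambda_gt0 mu_gt0 p_sum1 y01 root.
set x := y ^+ K.+1 in le_x Y_lt1; set x' := y' ^+ K.+2 in le_x.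
have x_lt1 : x < 1 by exact: exprk_lt1.
have x'_lt1 : x' < 1 by exact: exprk_lt1.
have x_ge0 : 0 <= x by rewrite exprn_ge0// ltW.
have x'_ge0 : 0 <= x' by rewrite exprn_ge0// ltW.
have le_L := le_mean_level lambda_gt0 mu_gt0 p_ge0 x'_ge0 le_x Y_lt1.
split.
- rewrite (mean_customersE lambda_gt0 mu_gt0 p_ge0 p_sum1 pi_stat y01 root).
  by rewrite (mean_customersE lambda_gt0 mu_gt0 p_ge0 p_sum1 pi'_stat y'01 root').
- have x01 : 0 <= x < 1 by rewrite x_ge0.
  have x'01 : 0 <= x' < 1 by rewrite x'_ge0.
  have arr := arrival_geometric lambda_gt0 mu_gt0 p_ge0 p_sum1 pi_stat y01 root.
  have arr' := arrival_geometric lambda_gt0 mu_gt0 p_ge0 p_sum1 pi'_stat y'01 root'.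
  rewrite (mean_sojournE mu_gt0 p_ge0 p_sum1 C x01 arr).
  rewrite (mean_sojournE mu_gt0 p_ge0 p_sum1 C' x'01 arr').
  rewrite (service_mean_eq mu_gt0 p_ge0 p_sum1 C C' x01 x'01 arr arr').
  have mean_ge0 : (0 <= service_mean C')%E by exact: integral_ge0.
  (* With a common mean service time, the two series compare term by term. *)
  apply: lee_nneseries => i; first by rewrite mule_ge0// lee_fin present_probability_ge0.
  by move=> _; rewrite lee_wpmul2r// lee_fin le_present_probability// x'_ge0.
- rewrite (variance_customersE lambda_gt0 mu_gt0 p_ge0 p_sum1 pi_stat y01 root).
  rewrite (variance_customersE lambda_gt0 mu_gt0 p_ge0 p_sum1 pi'_stat y'01 root').
  rewrite lee_fin; apply: le_modified_geometric_variance => //.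
  + exact: mean_level_gt0.
  + exact: ge_busy_probability.
  (* [1 - L' (1 - x')] is the probability of an empty system. *)
  + rewrite -subr_ge0 -(customers_pmf_zero lambda_gt0 mu_gt0 p_ge0 p_sum1 pi'_stat y'01 root').
    exact: customers_pmf_ge0 pi'_stat _.
Qed.
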